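(* For every $d\in\left[\frac12-\frac{\sqrt5}{10};\,1\right]$ there exists a real irrational number $\alpha$ such that $$\lim_{t\to\infty}\frac{I_\alpha(t)}{N(\alpha,t)}=d.$$
   Context: For a real irrational number $\alpha$ and real $t\ge 1$ put $\psi_\alpha(t)=\min_{1\le q\le t}\|q\alpha\|$, where $q$ runs over integers and $\|\cdot\|$ denotes the distance to the nearest integer, and $I_\alpha(t)=\int_1^t\psi_\alpha(\xi)\,d\xi$. Let $\alpha=[a_0;a_1,a_2,\ldots]$ be the regular continued fraction expansion of $\alpha$ and $p_\nu/q_\nu=[a_0;a_1,\ldots,a_\nu]$ ($\nu\ge 0$, in lowest terms, $q_\nu>0$, so $q_0=1$) its convergents. For $t>1$ the integer $N=N(\alpha,t)$ is defined by the condition $q_N\le t<q_{N+1}$. *)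

(* Defs.v *)
From Stdlib Require Import Reals QArith Qreduction Qreals List.
From Coquelicot Require Import Coquelicot.
Open Scope R_scope.

Definition irrational (x : R) : Prop := ~ exists r : Q, x = Q2R r.

Definition dist_int (x : R) : R := Rmin (frac_part x) (1 - frac_part x).

(* The minimum runs over the integers 1 <= q <= t.  The initial value of the
   fold is the term q = 1, which is among them as soon as t >= 1; values at
   t < 1 are never used. *)
Definition psi (alpha t : R) : R :=
  fold_right Rmin (dist_int (1 * alpha))
    (map (fun q : nat => dist_int (INR q * alpha))
       (seq 1 (Z.to_nat (Int_part t)))).

Definition I_psi (alpha t : R) : R := RInt (psi alpha) 1 t.

(* For irrational [alpha] no complete quotient is an integer, so the inverse
   below is never taken at 0. *)
Fixpoint complete_quotient (alpha : R) (n : nat) : R :=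
  match n with
  | O => alpha
  | S m => / frac_part (complete_quotient alpha m)
  end.

Definition partial_quotient (alpha : R) (n : nat) : Z :=
  Int_part (complete_quotient alpha n).

(* [finite_cf a n] is [a 0; a 1, ..., a n]. *)
Fixpoint finite_cf (a : nat -> Z) (n : nat) : Q :=
  match n with
  | O => inject_Z (a O)
  | S m => (inject_Z (a O) + / finite_cf (fun i => a (S i)) m)%Q
  end.

(* [Qred] puts a fraction in lowest terms and [QDen] is its positive
   denominator. *)
Definition convergent_den (alpha : R) (n : nat) : Z :=
  QDen (Qred (finite_cf (partial_quotient alpha) n)).

(* For irrational [alpha] and t > 1 there is exactly one such [N]: the
   denominators satisfy q_0 <= q_1 < q_2 < ..., and when q_0 = q_1 = 1 the
   condition excludes N = 0. *)
Definition is_convergent_index (alpha t : R) (N : nat) : Prop :=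
  IZR (convergent_den alpha N) <= t < IZR (convergent_den alpha (S N)).

(* Main.v *)
Require Import Defs.
From Stdlib Require Import Reals ZArith QArith Qcanon List.
From Stdlib Require Import ClassicalEpsilon Lia Lra.
From Coquelicot Require Import Coquelicot.
Open Scope R_scope.

(** Write [e_n = |q_n alpha - p_n|].  By the law of best approximation psi is
    constant, equal to [e_n], on [q_n <= t < q_(n+1)], so the integral up to
    [q_N] is the sum over [n < N] of the pieces [e_n (q_(n+1) - q_n)].  From
    [e_n q_(n+1) + e_(n+1) q_n = 1] such a piece equals
    [(1 - r_n) / (1 + r_n s_(n+1))], where [r_n = q_n / q_(n+1)] and
    [s_(n+1) = e_(n+1) / e_n].  Inside a long run of partial quotients 1 both
    ratios are close to [g = (sqrt 5 - 1) / 2] and the piece is close to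
    [(1 - g) / (1 + g^2) = 1/2 - sqrt 5 / 10], the lower end of the range of
    [d]; inside a long run of large partial quotients both are close to 0 and
    the piece is close to 1, the upper end.  Hence it suffices to alternate
    runs of ones and runs of growing partial quotients, with lengths tending
    to infinity and with the density [th] of ones for which
    [d = th (1/2 - sqrt 5 / 10) + (1 - th)].

    Quantitatively, the digit of index n (counted from [a_1]) has the type
    chosen for the block [k = floor (sqrt n)], so that only [sqrt N] changes of
    type occur before N, and the type of block k is
    [floor (th (k+1)) - floor (th k)], which has density [th] even when block k
    is weighted by its length [2k+1] ([floor_diff_discrepancy]).  The large
    digits are [n + 1].  The maps [x |-> 1 / (a + x)] contract distances to the
    expected ratio, up to an error [1 / (n+1)] ([inv_digit_contracts]).  The
    ratio [r] obeys such a recursion forwards and [s] backwards, so the sum of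
    all deviations is at most a constant times the number of type changes plus
    the sum of [1 / (n+1)]: everything is [O (sqrt N)]
    ([psum_piece_block_digits]).  The integral differs from [d N] by
    [O (sqrt N)], whence the limit. *)

(** * Continuants *)

Definition behead (a : nat -> Z) (n : nat) : Z := a (S n).

(** [continuant a n] is the continuant K(a_0, ..., a_(n-1)).  Expanding at the
    left end matches the recursion of [finite_cf]. *)
Fixpoint continuant (a : nat -> Z) (n : nat) : Z :=
  match n with
  | O => 1
  | S m => a O * continuant (behead a) m +
           match m with
           | O => 0
           | S k => continuant (behead (behead a)) k
           end
  end%Z.

Lemma continuant_recl a n :
  continuant a (S (S n)) =
  (a O * continuant (behead a) (S n) + continuant (behead (behead a)) n)%Z.
Proof. reflexivity. Qed.

(** Expansion at the right end, which gives the recurrences of the convergents.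
    The left expansion reaches back two steps, so two consecutive instances are
    carried through the induction. *)
Lemma continuant_recr_pair n : forall a,
  (continuant a (S (S n)) =
     a (S n) * continuant a (S n) + continuant a n)%Z /\
  (continuant a (S (S (S n))) =
     a (S (S n)) * continuant a (S (S n)) + continuant a (S n))%Z.
Proof.
  induction n as [|n IH]; intro a.
  - split; cbn; unfold behead; ring.
  - split; [exact (proj2 (IH a))|].
    rewrite (continuant_recl a (S (S n))), (proj2 (IH (behead a))),
      (proj1 (IH (behead (behead a)))), (continuant_recl a (S n)),
      (continuant_recl a n).
    unfold behead; ring.
Qed.

Lemma continuant_recr a n :
  (continuant a (S (S n)) = a (S n) * continuant a (S n) + continuant a n)%Z.
Proof. apply continuant_recr_pair. Qed.

Lemma continuant_pos n : forall a, (forall i, 1 <= a i)%Z -> (1 <= continuant a n)%Z.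
Proof.
  enough (H : forall a, (forall i, 1 <= a i)%Z ->
            (1 <= continuant a n)%Z /\ (1 <= continuant a (S n))%Z)
    by (intros a Ha; apply (H a Ha)).
  induction n as [|n IH]; intros a Ha.
  - cbn; specialize (Ha O); lia.
  - destruct (IH a Ha) as [H1 H2]; split; [exact H2|].
    rewrite continuant_recr; specialize (Ha (S n)); nia.
Qed.

Lemma continuant_gcd n : forall a,
  Z.gcd (continuant a (S n)) (continuant (behead a) n) = 1%Z.
Proof.
  induction n as [|n IH]; intro a.
  - apply Z.gcd_1_r.
  - rewrite continuant_recl, Z.gcd_comm, Z.add_comm, Z.gcd_add_mult_diag_r.
    apply IH.
Qed.

Lemma continuant_det a n :
  IZR (continuant a (S (S n)) * continuant (behead a) n
       - continuant a (S n) * continuant (behead a) (S n)) = (-1) ^ n.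
Proof.
  induction n as [|n IH].
  - cbn [pow]; apply f_equal; cbn; unfold behead; ring.
  - cbn [pow]; rewrite <- IH, <- mult_IZR; apply f_equal.
    rewrite (continuant_recr a (S n)), (continuant_recr (behead a) n).
    change (behead a (S n)) with (a (S (S n))); ring.
Qed.

Lemma finite_cf_continuant n : forall a, (forall i, 1 <= a (S i))%Z ->
  (finite_cf a n ==
   inject_Z (continuant a (S n)) / inject_Z (continuant (behead a) n))%Q.
Proof.
  assert (nz : forall z, (1 <= z)%Z -> ~ (inject_Z z == 0)%Q).
  { intros z Hz E; unfold Qeq in E; cbn in E; lia. }
  induction n as [|n IH]; intros a Ha.
  - cbn [finite_cf continuant]; rewrite inject_Z_plus, inject_Z_mult; field.
  - cbn [finite_cf]; change (fun i => a (S i)) with (behead a).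
    rewrite IH by (intro i; apply Ha).
    rewrite (continuant_recl a n), inject_Z_plus, inject_Z_mult.
    field; split; apply nz, continuant_pos; intro i; apply Ha.
Qed.

(** The continuants are coprime, so they are already the reduced form of the
    fraction. *)
Lemma finite_cf_denom a n : (forall i, 1 <= a (S i))%Z ->
  QDen (Qred (finite_cf a n)) = continuant (behead a) n.
Proof.
  intro Ha.
  assert (Hq : (1 <= continuant (behead a) n)%Z)
    by (apply continuant_pos; intro i; apply Ha).
  assert (Hd : Zpos (Z.to_pos (continuant (behead a) n)) = continuant (behead a) n)
    by (apply Z2Pos.id; lia).
  rewrite (Qred_complete _ (continuant a (S n) # Z.to_pos (continuant (behead a) n))%Q).
  - rewrite Qred_identity; cbn [Qnum Qden]; [exact Hd|].
    rewrite Hd; apply continuant_gcd.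
  - rewrite finite_cf_continuant by exact Ha.
    rewrite (Qmake_Qdiv (continuant a (S n))), Hd; reflexivity.
Qed.

(** * Distance to the nearest integer *)

Lemma dist_int_le x p : dist_int x <= Rabs (x - IZR p).
Proof.
  unfold dist_int, frac_part.
  destruct (base_Int_part x) as [H1 H2].
  destruct (Z_le_gt_dec p (Int_part x)) as [H|H].
  - apply IZR_le in H; rewrite Rabs_pos_eq by lra.
    eapply Rle_trans; [apply Rmin_l|lra].
  - assert (H3 : (Int_part x + 1 <= p)%Z) by lia.
    apply IZR_le in H3; rewrite plus_IZR in H3.
    rewrite Rabs_left1 by lra.
    eapply Rle_trans; [apply Rmin_r|lra].
Qed.

Lemma dist_int_attained x : exists p, dist_int x = Rabs (x - IZR p).
Proof.
  unfold dist_int, frac_part.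
  destruct (base_Int_part x) as [H1 H2].
  destruct (Rmin_case_strong (x - IZR (Int_part x)) (1 - (x - IZR (Int_part x)))
    (fun m => m = x - IZR (Int_part x) \/ m = 1 - (x - IZR (Int_part x)))) as [E|E];
    try (intros; tauto); rewrite E.
  - exists (Int_part x); rewrite Rabs_pos_eq; lra.
  - exists (Int_part x + 1)%Z; rewrite plus_IZR, Rabs_left1; lra.
Qed.

(** * Convergents and their errors *)

(** [A n] plays the role of the partial quotient [a_(n+1)], and [a_0] is 0. *)
Definition digits (A : nat -> Z) (n : nat) : Z :=
  match n with O => 0%Z | S m => A m end.

Definition denom (A : nat -> Z) (n : nat) : R := IZR (continuant A n).
Definition numer (A : nat -> Z) (n : nat) : R := IZR (continuant (digits A) (S n)).

(** The sign records on which side of [x] the n-th convergent should lie: for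
    positive digits, [x] is the value of the continued fraction as soon as no
    error is negative. *)
Definition err (A : nat -> Z) (x : R) (n : nat) : R :=
  (-1) ^ n * (denom A n * x - numer A n).

Lemma denom_0 A : denom A 0 = 1.
Proof. reflexivity. Qed.
Lemma denom_1 A : denom A 1 = IZR (A O).
Proof. unfold denom; apply f_equal; cbn; ring. Qed.
Lemma numer_0 A : numer A 0 = 0.
Proof. reflexivity. Qed.
Lemma numer_1 A : numer A 1 = 1.
Proof. reflexivity. Qed.

Lemma denom_rec A n : denom A (S (S n)) = IZR (A (S n)) * denom A (S n) + denom A n.
Proof. unfold denom; rewrite continuant_recr, plus_IZR, mult_IZR; reflexivity. Qed.

Lemma numer_rec A n : numer A (S (S n)) = IZR (A (S n)) * numer A (S n) + numer A n.
Proof. unfold numer; rewrite continuant_recr, plus_IZR, mult_IZR; reflexivity. Qed.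

Lemma numer_denom_det A n : numer A (S n) * denom A n - numer A n * denom A (S n) = (-1) ^ n.
Proof.
  unfold numer, denom; rewrite <- !mult_IZR, <- minus_IZR.
  apply (continuant_det (digits A) n).
Qed.

Lemma sign_sq n : (-1) ^ n * (-1) ^ n = 1.
Proof. rewrite <- pow_add, <- (pow_1_even n); f_equal; lia. Qed.

Lemma sign_cases n : (-1) ^ n = 1 \/ (-1) ^ n = -1.
Proof. induction n as [|n [H|H]]; cbn [pow]; rewrite ?H; lra. Qed.

Lemma err_0 A x : err A x 0 = x.
Proof. unfold err; rewrite denom_0, numer_0; cbn [pow]; ring. Qed.

Lemma err_1 A x : 1 = IZR (A O) * err A x 0 + err A x 1.
Proof. unfold err; rewrite denom_0, numer_0, denom_1, numer_1; cbn [pow]; ring. Qed.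

Lemma err_rec A x n : err A x n = IZR (A (S n)) * err A x (S n) + err A x (S (S n)).
Proof. unfold err; rewrite denom_rec, numer_rec; cbn [pow]; ring. Qed.

Lemma err_denom A x n : err A x n * denom A (S n) + err A x (S n) * denom A n = 1.
Proof.
  transitivity ((-1) ^ n * (numer A (S n) * denom A n - numer A n * denom A (S n))).
  - unfold err; cbn [pow]; ring.
  - rewrite numer_denom_det; apply sign_sq.
Qed.

Lemma denom_ge_1 A n : (forall i, 1 <= A i)%Z -> 1 <= denom A n.
Proof. intro HA; apply IZR_le, continuant_pos, HA. Qed.

Lemma denom_le_S A n : (forall i, 1 <= A i)%Z -> denom A n <= denom A (S n).
Proof.
  intro HA; destruct n as [|n].
  - rewrite denom_0; apply denom_ge_1, HA.
  - rewrite denom_rec; pose proof (denom_ge_1 A n HA); pose proof (denom_ge_1 A (S n) HA).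
    pose proof (IZR_le _ _ (HA (S n))); nra.
Qed.

Lemma denom_mono A n m : (forall i, 1 <= A i)%Z -> (n <= m)%nat -> denom A n <= denom A m.
Proof.
  intros HA H; induction H as [|m _ IH]; [lra|].
  pose proof (denom_le_S A m HA); lra.
Qed.

Lemma denom_ge_index A n : (forall i, 1 <= A i)%Z -> INR n <= denom A n.
Proof.
  intro HA.
  enough (INR n <= denom A n /\ INR (S n) <= denom A (S n)) by tauto.
  induction n as [|n [IH1 IH2]].
  - cbn; rewrite denom_0; pose proof (denom_ge_1 A 1 HA); lra.
  - split; [exact IH2|].
    rewrite denom_rec, (S_INR (S n)).
    pose proof (denom_ge_1 A n HA); pose proof (denom_ge_1 A (S n) HA).
    pose proof (IZR_le _ _ (HA (S n))); nra.
Qed.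

(** The convergents are the partial sums of the alternating series with terms
    [1 / (q_n q_(n+1))]; its sum lies between any two consecutive ones. *)
Lemma continued_fraction_converges A : (forall i, 1 <= A i)%Z ->
  exists alpha, forall n, 0 <= err A alpha n.
Proof.
  intro HA.
  set (U := fun n => / (denom A n * denom A (S n))).
  assert (Hd : forall n, 0 < denom A n) by (intro n; pose proof (denom_ge_1 A n HA); lra).
  assert (Hdec : Un_decreasing U).
  { intro n; unfold U; apply Rinv_le_contravar.
    - apply Rmult_lt_0_compat; apply Hd.
    - rewrite (Rmult_comm (denom A (S n))); apply Rmult_le_compat_r; [left; apply Hd|].
      apply denom_mono; [exact HA|lia]. }
  assert (Hlim : Un_cv U 0).
  { intros e He.
    destruct (archimed_cor1 e He) as [m [Hm Hm0]]; exists m.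
    intros n Hn; unfold Rdist; rewrite Rminus_0_r; unfold U.
    rewrite Rabs_pos_eq by (left; apply Rinv_0_lt_compat, Rmult_lt_0_compat; apply Hd).
    apply Rle_lt_trans with (/ INR m); [|exact Hm].
    apply lt_INR in Hm0; cbn in Hm0.
    apply Rinv_le_contravar; [exact Hm0|].
    pose proof (denom_ge_index A n HA); pose proof (denom_ge_1 A (S n) HA).
    pose proof (le_INR _ _ Hn); nra. }
  assert (Hsum : forall n, sum_f_R0 (tg_alt U) n = numer A (S n) / denom A (S n)).
  { induction n as [|n IH].
    - cbn [sum_f_R0]; unfold tg_alt, U; rewrite denom_0, numer_1; cbn [pow].
      field; apply Rgt_not_eq, Hd.
    - cbn [sum_f_R0]; rewrite IH; unfold tg_alt, U.
      rewrite <- (numer_denom_det A); field; split; apply Rgt_not_eq, Hd. }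
  destruct (alternated_series U Hdec Hlim) as [l Hl].
  assert (Hb : forall n, numer A (S (S (2 * n))) / denom A (S (S (2 * n))) <= l
                         <= numer A (S (2 * n)) / denom A (S (2 * n))).
  { intro n; rewrite <- !Hsum; apply (alternated_series_ineq U l n Hdec Hlim Hl). }
  assert (Hodd : forall n, 0 <= err A l (S (2 * n))).
  { intro n; unfold err; rewrite pow_1_odd.
    pose proof (Hd (S (2 * n))); destruct (Hb n) as [_ H1].
    apply (Rmult_le_compat_r (denom A (S (2 * n)))) in H1; [|lra].
    replace (numer A (S (2 * n)) / denom A (S (2 * n)) * denom A (S (2 * n)))
      with (numer A (S (2 * n))) in H1 by (field; lra).
    lra. }
  assert (Heven : forall n, 0 <= err A l (S (S (2 * n)))).
  { intro n; unfold err.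
    replace ((-1) ^ S (S (2 * n))) with 1
      by (rewrite <- (pow_1_even (S n)); f_equal; lia).
    pose proof (Hd (S (S (2 * n)))); destruct (Hb n) as [H1 _].
    apply (Rmult_le_compat_r (denom A (S (S (2 * n))))) in H1; [|lra].
    replace (numer A (S (S (2 * n))) / denom A (S (S (2 * n))) * denom A (S (S (2 * n))))
      with (numer A (S (S (2 * n)))) in H1 by (field; lra).
    lra. }
  exists l; intros [|n].
  - rewrite err_rec.
    pose proof (Hodd O); pose proof (Heven O); cbn [Nat.mul Nat.add] in *.
    pose proof (IZR_le _ _ (HA 1%nat)); nra.
  - destruct (Nat.Even_or_Odd n) as [[k ->]|[k ->]]; [apply Hodd|].
    rewrite Nat.add_1_r; apply Heven.
Qed.

(** Two consecutive errors cannot both vanish, by [err_denom], and a vanishing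
    error would force the next one to vanish by [err_rec]. *)
Lemma err_pos A x : (forall i, 1 <= A i)%Z -> (forall n, 0 <= err A x n) ->
  forall n, 0 < err A x n.
Proof.
  intros HA H n.
  pose proof (err_rec A x n); pose proof (err_denom A x n).
  pose proof (H n); pose proof (H (S n)); pose proof (H (S (S n))).
  pose proof (IZR_le _ _ (HA (S n))).
  destruct (Req_dec (err A x n) 0) as [E|E]; [|lra].
  assert (E' : err A x (S n) = 0) by nra.
  rewrite E, E' in *; lra.
Qed.

Lemma err_lt_S A x n : (forall i, 1 <= A i)%Z -> (forall n, 0 < err A x n) ->
  err A x (S n) < err A x n.
Proof.
  intros HA H; rewrite (err_rec A x n).
  pose proof (H (S n)); pose proof (H (S (S n))).
  pose proof (IZR_le _ _ (HA (S n))); nra.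
Qed.

(** Infinite descent on the errors, which are integral combinations of 1 and
    [x]. *)
Lemma err_pos_irrational A x : (forall i, 1 <= A i)%Z ->
  (forall n, 0 < err A x n) -> irrational x.
Proof.
  intros HA H [r Hr].
  assert (Hv : 0 < IZR (Zpos (Qden r))) by (apply IZR_lt; reflexivity).
  assert (Hx : IZR (Zpos (Qden r)) * x = IZR (Qnum r))
    by (rewrite Hr; unfold Q2R; field; lra).
  (* multiplied by the denominator of x, the errors would be a strictly
     decreasing sequence of positive integers *)
  assert (Hz : forall n, exists z, IZR (Zpos (Qden r)) * err A x n = IZR z).
  { intro n; destruct (sign_cases n) as [E|E]; unfold err, denom, numer; rewrite E.
    - exists (continuant A n * Qnum r - Zpos (Qden r) * continuant (digits A) (S n))%Z.
      rewrite minus_IZR, !mult_IZR, <- Hx; ring.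
    - exists (- (continuant A n * Qnum r - Zpos (Qden r) * continuant (digits A) (S n)))%Z.
      rewrite opp_IZR, minus_IZR, !mult_IZR, <- Hx; ring. }
  destruct (Hz O) as [z0 Hz0].
  assert (Hdown : forall n z, IZR (Zpos (Qden r)) * err A x n = IZR z ->
             (z <= z0 - Z.of_nat n)%Z).
  { induction n as [|n IH]; intros z Ez.
    - rewrite Hz0 in Ez; apply eq_IZR in Ez; lia.
    - destruct (Hz n) as [z' Ez']; specialize (IH z' Ez').
      assert (Hlt : (z < z')%Z).
      { apply lt_IZR; rewrite <- Ez, <- Ez'.
        apply Rmult_lt_compat_l; [exact Hv|apply err_lt_S; assumption]. }
      lia. }
  destruct (Hz (Z.to_nat z0)) as [z Ez].
  pose proof (Hdown _ _ Ez).
  assert (0 < z)%Z by (apply lt_IZR; rewrite <- Ez; apply Rmult_lt_0_compat; auto).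
  destruct (Hz O) as [z1 Ez1].
  pose proof (Hdown _ _ Ez1).
  lia.
Qed.

(** With the convention that the error of index -1 is 1, this is the quotient of
    consecutive errors; for the value [x] of the continued fraction it equals
    [0; A n, A (n+1), ...], the fractional part of the n-th complete quotient. *)
Definition err_ratio (A : nat -> Z) (x : R) (n : nat) : R :=
  match n with O => err A x 0 | S m => err A x (S m) / err A x m end.

Lemma err_ratio_rec A x n : (forall n, 0 < err A x n) ->
  / err_ratio A x n = IZR (A n) + err_ratio A x (S n).
Proof.
  intro H; destruct n as [|n]; cbn [err_ratio].
  - apply (Rmult_eq_reg_l (err A x 0)); [|apply Rgt_not_eq, H].
    rewrite Rinv_r by (apply Rgt_not_eq, H).
    rewrite (err_1 A x) at 1; field; apply Rgt_not_eq, H.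
  - rewrite Rinv_div, (err_rec A x n); field; apply Rgt_not_eq, H.
Qed.

Lemma err_ratio_bounds A x n : (forall i, 1 <= A i)%Z -> (forall n, 0 < err A x n) ->
  0 < err_ratio A x n < 1.
Proof.
  intros HA H; destruct n as [|n]; cbn [err_ratio].
  - pose proof (H O); pose proof (H 1%nat); pose proof (err_1 A x).
    pose proof (IZR_le _ _ (HA O)); nra.
  - split; [apply Rdiv_lt_0_compat; apply H|].
    apply Rlt_div_l; [apply H|].
    rewrite Rmult_1_l; apply err_lt_S; assumption.
Qed.

Lemma frac_part_unique x z f : x = IZR z + f -> 0 <= f < 1 ->
  Int_part x = z /\ frac_part x = f.
Proof.
  intros E Hf.
  assert (Ez : Int_part x = z) by (symmetry; apply Int_part_spec; lra).
  split; [exact Ez|unfold frac_part; rewrite Ez; lra].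
Qed.

(** Positivity of all errors makes the [A n] the partial quotients: the
    error quotients lie in (0, 1) and satisfy the recursion of the complete
    quotients. *)
Lemma partial_quotient_digits A x n : (forall i, 1 <= A i)%Z ->
  (forall n, 0 < err A x n) -> partial_quotient x n = digits A n.
Proof.
  intros HA H.
  enough (E : Int_part (complete_quotient x n) = digits A n /\
              frac_part (complete_quotient x n) = err_ratio A x n) by apply E.
  induction n as [|n [_ IH]].
  - apply frac_part_unique; [cbn; rewrite err_0; ring|].
    pose proof (err_ratio_bounds A x O HA H); lra.
  - apply frac_part_unique.
    + cbn [complete_quotient digits]; rewrite IH; apply err_ratio_rec, H.
    + pose proof (err_ratio_bounds A x (S n) HA H); lra.
Qed.

Lemma finite_cf_ext n : forall a b, (forall i, a i = b i) -> finite_cf a n = finite_cf b n.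
Proof.
  induction n as [|n IH]; intros a b H; cbn [finite_cf]; rewrite H; [reflexivity|].
  rewrite (IH (fun i => a (S i)) (fun i => b (S i))); [reflexivity|].
  intro i; apply H.
Qed.

Lemma convergent_denom_eq A x n : (forall i, 1 <= A i)%Z ->
  (forall n, 0 < err A x n) -> IZR (convergent_den x n) = denom A n.
Proof.
  intros HA H; unfold convergent_den, denom; apply f_equal.
  rewrite (finite_cf_ext n _ (digits A))
    by (intro i; apply partial_quotient_digits; assumption).
  apply finite_cf_denom; exact HA.
Qed.

(** Law of best approximation.  In the basis formed by the n-th and the next
    convergent, the pair (u, v) has coordinates (a, b) that cannot have the same
    sign when [0 < u < q_(n+1)]; since the errors of the two convergents have
    opposite signs, the two contributions add up. *)
Lemma best_approximation A x n (u v : Z) : (forall i, 1 <= A i)%Z ->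
  (forall n, 0 < err A x n) -> (0 < u)%Z -> IZR u < denom A (S n) ->
  err A x n <= Rabs (IZR u * x - IZR v).
Proof.
  intros HA H Hu Hu1.
  set (q0 := continuant A n); set (q1 := continuant A (S n)).
  set (p0 := continuant (digits A) (S n)); set (p1 := continuant (digits A) (S (S n))).
  assert (Hq0 : (1 <= q0)%Z) by (apply continuant_pos, HA).
  assert (Hq1 : (u < q1)%Z) by (apply lt_IZR; exact Hu1).
  (* Cramer's rule for a matrix of determinant 1 or -1 *)
  assert (Hco : exists a b : Z, u = (a * q0 + b * q1)%Z /\ v = (a * p0 + b * p1)%Z).
  { pose proof (continuant_det (digits A) n) as D.
    change (continuant (behead (digits A)) n) with q0 in D.
    change (continuant (behead (digits A)) (S n)) with q1 in D.
    fold p0 p1 in D.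
    destruct (sign_cases n) as [E|E]; rewrite E in D; apply eq_IZR in D.
    - exists (u * p1 - v * q1)%Z, (v * q0 - u * p0)%Z; split.
      + transitivity (u * (p1 * q0 - p0 * q1))%Z; [rewrite D|]; ring.
      + transitivity (v * (p1 * q0 - p0 * q1))%Z; [rewrite D|]; ring.
    - exists (- (u * p1 - v * q1))%Z, (- (v * q0 - u * p0))%Z; split.
      + transitivity (- u * (p1 * q0 - p0 * q1))%Z; [rewrite D|]; ring.
      + transitivity (- v * (p1 * q0 - p0 * q1))%Z; [rewrite D|]; ring. }
  destruct Hco as [a [b [Eu Ev]]].
  assert (E : Rabs (IZR u * x - IZR v) = Rabs (IZR a * err A x n - IZR b * err A x (S n))).
  { transitivity (Rabs ((-1) ^ n * (IZR u * x - IZR v))).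
    - rewrite Rabs_mult, pow_1_abs; ring.
    - rewrite Eu, Ev, !plus_IZR, !mult_IZR; unfold err, denom, numer; fold q0 q1 p0 p1.
      f_equal; cbn [pow]; ring. }
  rewrite E; pose proof (H n) as H0; pose proof (H (S n)) as H1.
  assert (Hab : (1 <= a /\ b <= 0)%Z \/ (a <= -1 /\ 0 <= b)%Z).
  { destruct (Z_le_gt_dec b 0) as [Hb|Hb]; [left|right].
    - assert (0 < a * q0)%Z by nia; nia.
    - assert (a * q0 < 0)%Z by nia; nia. }
  destruct Hab as [[Ha Hb]|[Ha Hb]]; apply IZR_le in Ha, Hb.
  - eapply Rle_trans; [|apply Rle_abs]; nra.
  - rewrite <- Rabs_Ropp; eapply Rle_trans; [|apply Rle_abs]; nra.
Qed.

(** * The function psi and its integral *)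

Lemma fold_Rmin_ge l m x : m <= x -> (forall y, In y l -> m <= y) ->
  m <= fold_right Rmin x l.
Proof.
  induction l as [|y l IH]; intros Hx Hl; cbn; [exact Hx|].
  apply Rmin_glb; [apply Hl; left; reflexivity|].
  apply IH; [exact Hx|intros z Hz; apply Hl; right; exact Hz].
Qed.

Lemma fold_Rmin_le l x y : In y l -> fold_right Rmin x l <= y.
Proof.
  induction l as [|z l IH]; cbn; [tauto|].
  intros [->|H]; [apply Rmin_l|].
  eapply Rle_trans; [apply Rmin_r|auto].
Qed.

Lemma psi_between_convergents A x n t : (forall i, 1 <= A i)%Z ->
  (forall n, 0 < err A x n) -> denom A n <= t < denom A (S n) -> psi x t = err A x n.
Proof.
  intros HA H [Ht1 Ht2].
  pose proof (denom_ge_1 A n HA) as Hd.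
  destruct (base_Int_part t) as [Hi1 Hi2].
  assert (Hge : forall u, (0 < u)%Z -> IZR u <= t -> err A x n <= dist_int (IZR u * x)).
  { intros u Hu Hut; destruct (dist_int_attained (IZR u * x)) as [v ->].
    apply best_approximation; [exact HA|exact H|exact Hu|lra]. }
  unfold psi; apply Rle_antisym.
  - apply Rle_trans with (dist_int (denom A n * x)).
    + apply fold_Rmin_le, in_map_iff.
      exists (Z.to_nat (continuant A n)); split.
      * rewrite INR_IZR_INZ, Z2Nat.id; [reflexivity|].
        pose proof (continuant_pos n A HA); lia.
      * pose proof (continuant_pos n A HA) as Hp.
        assert (Hc : (continuant A n < Int_part t + 1)%Z)
          by (apply lt_IZR; rewrite plus_IZR; fold (denom A n); lra).
        apply in_seq; lia.
    + eapply Rle_trans; [apply (dist_int_le _ (continuant (digits A) (S n)))|].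
      fold (numer A n); apply Req_le.
      rewrite <- (Rabs_pos_eq (err A x n)) by (left; apply H).
      unfold err; rewrite Rabs_mult, pow_1_abs; ring.
  - apply fold_Rmin_ge; [apply Hge; [reflexivity|lra]|].
    intros y Hy; apply in_map_iff in Hy; destruct Hy as [u [<- Hu]].
    apply in_seq in Hu; rewrite INR_IZR_INZ; apply Hge; [lia|].
    apply Rle_trans with (IZR (Int_part t)); [apply IZR_le; lia|exact Hi1].
Qed.

Fixpoint psum (f : nat -> R) (n : nat) : R :=
  match n with O => 0 | S m => psum f m + f m end.

(** The integral of psi from [q_n] to [q_(n+1)]. *)
Definition piece (A : nat -> Z) (x : R) (n : nat) : R :=
  err A x n * (denom A (S n) - denom A n).

Lemma is_RInt_psi_piece A x n t : (forall i, 1 <= A i)%Z ->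
  (forall n, 0 < err A x n) -> denom A n <= t <= denom A (S n) ->
  is_RInt (psi x) (denom A n) t (err A x n * (t - denom A n)).
Proof.
  intros HA H Ht.
  apply is_RInt_ext with (fun _ => err A x n).
  - intros y Hy; rewrite Rmin_left, Rmax_right in Hy by lra.
    symmetry; apply psi_between_convergents; [exact HA|exact H|lra].
  - replace (err A x n * (t - denom A n)) with (scal (t - denom A n) (err A x n)).
    + apply (is_RInt_const (V := R_NormedModule)).
    + unfold scal; cbn; unfold mult; cbn; ring.
Qed.

Lemma is_RInt_psi_denom A x n : (forall i, 1 <= A i)%Z -> (forall n, 0 < err A x n) ->
  is_RInt (psi x) 1 (denom A n) (psum (piece A x) n).
Proof.
  intros HA H; induction n as [|n IH].
  - rewrite denom_0; apply (is_RInt_point (V := R_NormedModule)).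
  - apply (is_RInt_Chasles (V := R_NormedModule) _ _ (denom A n) _ _ _ IH).
    apply is_RInt_psi_piece; [exact HA|exact H|].
    pose proof (denom_le_S A n HA); lra.
Qed.

Lemma I_psi_eq A x n t : (forall i, 1 <= A i)%Z -> (forall n, 0 < err A x n) ->
  denom A n <= t < denom A (S n) ->
  I_psi x t = psum (piece A x) n + err A x n * (t - denom A n).
Proof.
  intros HA H Ht; apply is_RInt_unique.
  apply (is_RInt_Chasles (V := R_NormedModule) _ _ (denom A n)).
  - apply is_RInt_psi_denom; assumption.
  - apply is_RInt_psi_piece; [exact HA|exact H|lra].
Qed.

(** * Pieces of the integral as functions of neighbouring ratios *)

(** A potential [P] whose increments dominate the terms bounds the sum; this
    replaces summation by parts and the handling of geometric series. *)
Lemma psum_dist_telescope (f h P : nat -> R) N :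
  (forall n, Rabs (f n - h n) <= P (S n) - P n) ->
  Rabs (psum f N - psum h N) <= P N - P O.
Proof.
  intro H; induction N as [|N IH]; cbn [psum].
  - rewrite Rminus_diag, Rabs_R0; lra.
  - replace (psum f N + f N - (psum h N + h N))
      with ((psum f N - psum h N) + (f N - h N)) by ring.
    eapply Rle_trans; [apply Rabs_triang|].
    specialize (H N); lra.
Qed.

(** The value of [0; 1, 1, ...]. *)
Definition golden : R := (sqrt 5 - 1) / 2.
(** The limit of the pieces for the digits 1, 1, ... . *)
Definition golden_piece : R := 1 / 2 - sqrt 5 / 10.

Lemma golden_sqr : golden * golden = 1 - golden.
Proof.
  pose proof (sqrt_sqrt 5 ltac:(lra)); unfold golden; nra.
Qed.

Lemma golden_bounds : 1 / 2 < golden < 2 / 3.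
Proof.
  pose proof (sqrt_sqrt 5 ltac:(lra)); pose proof (sqrt_pos 5).
  unfold golden; split; nra.
Qed.

Lemma golden_pieceE : golden_piece * (1 + golden * golden) = 1 - golden.
Proof.
  pose proof (sqrt_sqrt 5 ltac:(lra)); rewrite golden_sqr.
  unfold golden_piece, golden; nra.
Qed.

(** The type [true] stands for the digit 1 and [false] for a large digit;
    [ratio_limit] and [piece_limit] are the values that the ratios and the pieces
    approach in a long run of one type. *)
Definition ratio_limit (b : bool) : R := if b then golden else 0.
Definition piece_limit (b : bool) : R := if b then golden_piece else 1.
Definition mixed_digits (b : nat -> bool) (n : nat) : Z :=
  if b n then 1%Z else Z.of_nat (S n).
Definition denom_ratio (A : nat -> Z) (n : nat) : R := denom A n / denom A (S n).

Lemma mixed_digits_ge_1 b n : (1 <= mixed_digits b n)%Z.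
Proof. unfold mixed_digits; destruct (b n); lia. Qed.

(** For the digit 1 the map [1 / (1 + x)] fixes [golden] and contracts towards it
    by the factor [golden]; for the digit [n + 1] the value itself is at most
    [1 / (n + 1)]. *)
Lemma inv_digit_contracts b n x : 0 <= x ->
  Rabs (/ (IZR (mixed_digits b n) + x) - ratio_limit (b n))
  <= golden * Rabs (x - ratio_limit (b n)) + / INR (S n).
Proof.
  intro Hx; pose proof golden_bounds; pose proof golden_sqr.
  assert (Hn : 0 < / INR (S n)) by (apply Rinv_0_lt_compat, lt_0_INR; lia).
  unfold mixed_digits, ratio_limit; destruct (b n).
  - replace (/ (1 + x) - golden) with (golden * (golden - x) * / (1 + x)).
    2: { apply (Rmult_eq_reg_r (1 + x)); [|lra].
         rewrite Rmult_assoc, Rinv_l by lra.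
         rewrite Rmult_minus_distr_r, Rinv_l by lra; nra. }
    rewrite !Rabs_mult, (Rabs_pos_eq golden), (Rabs_minus_sym golden x) by lra.
    rewrite (Rabs_pos_eq (/ (1 + x))) by (left; apply Rinv_0_lt_compat; lra).
    assert (/ (1 + x) <= 1) by (rewrite <- Rinv_1; apply Rinv_le_contravar; lra).
    assert (0 <= golden * Rabs (x - golden))
      by (apply Rmult_le_pos; [lra|apply Rabs_pos]).
    nra.
  - rewrite <- INR_IZR_INZ, !Rminus_0_r.
    pose proof (lt_0_INR (S n) ltac:(lia)).
    rewrite Rabs_pos_eq by (left; apply Rinv_0_lt_compat; lra).
    assert (/ (INR (S n) + x) <= / INR (S n)) by (apply Rinv_le_contravar; lra).
    pose proof (Rabs_pos x); nra.
Qed.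

Lemma denom_ratio_bounds A n : (forall i, 1 <= A i)%Z -> 0 < denom_ratio A n <= 1.
Proof.
  intro HA; unfold denom_ratio.
  pose proof (denom_ge_1 A n HA); pose proof (denom_le_S A n HA).
  split; [apply Rdiv_lt_0_compat; lra|].
  apply Rle_div_l; lra.
Qed.

Lemma denom_ratio_rec A n : (forall i, 1 <= A i)%Z ->
  denom_ratio A (S n) = / (IZR (A (S n)) + denom_ratio A n).
Proof.
  intro HA; unfold denom_ratio; rewrite denom_rec.
  pose proof (denom_ge_1 A n HA); pose proof (denom_ge_1 A (S n) HA).
  pose proof (IZR_le _ _ (HA (S n))).
  field; repeat split; nra.
Qed.

(** This is [err_denom] divided by its first term. *)
Lemma piece_ratio A x n : (forall i, 1 <= A i)%Z -> (forall n, 0 < err A x n) ->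
  piece A x n * (1 + denom_ratio A n * err_ratio A x (S n)) = 1 - denom_ratio A n.
Proof.
  intros HA H; cbn [err_ratio]; unfold piece, denom_ratio.
  pose proof (denom_ge_1 A (S n) HA); pose proof (H n).
  replace (1 + denom A n / denom A (S n) * (err A x (S n) / err A x n))
    with ((err A x n * denom A (S n) + err A x (S n) * denom A n)
          / (err A x n * denom A (S n))) by (field; lra).
  rewrite err_denom; field; lra.
Qed.

Lemma piece_limit_ratio b :
  piece_limit b * (1 + ratio_limit b * ratio_limit b) = 1 - ratio_limit b.
Proof.
  destruct b; cbn; [apply golden_pieceE|ring].
Qed.

(** The function [(1 - r) / (1 + r s)] near the diagonal point [r = s = c], in a
    form free of division. *)
Lemma quotient_lipschitz r s c y z : 0 <= r <= 1 -> 0 <= s <= 1 -> 0 <= c <= 1 ->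
  y * (1 + r * s) = 1 - r -> z * (1 + c * c) = 1 - c ->
  Rabs (y - z) <= 2 * Rabs (r - c) + 2 * Rabs (s - c).
Proof.
  intros Hr Hs Hc Ey Ez.
  assert (Hcc : 0 <= c * c) by nra.
  assert (Hz : 0 <= z <= 1).
  { split; apply (Rmult_le_reg_r (1 + c * c)); lra. }
  (* (y - z)(1 + rs) = (c - r) - z (rs - cc) with rs - cc = s (r - c) + c (s - c) *)
  assert (E : (y - z) * (1 + r * s) = (c - r) * (1 + z * s) - (s - c) * (z * c)).
  { rewrite Rmult_minus_distr_r, Ey.
    transitivity (1 - r - z * (1 + r * s) + (z * (1 + c * c) - (1 - c)));
      [rewrite Ez|]; ring. }
  assert (Hy : Rabs (y - z) <= Rabs ((y - z) * (1 + r * s))).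
  { assert (Hrs : 0 <= r * s) by nra.
    rewrite Rabs_mult, (Rabs_pos_eq (1 + r * s)) by lra.
    pose proof (Rmult_le_pos _ _ (Rabs_pos (y - z)) Hrs); lra. }
  eapply Rle_trans; [exact Hy|]; rewrite E.
  eapply Rle_trans; [apply Rabs_triang|].
  rewrite Rabs_Ropp, (Rabs_mult (c - r)), (Rabs_mult (s - c)), (Rabs_minus_sym c r).
  rewrite (Rabs_pos_eq (1 + z * s)), (Rabs_pos_eq (z * c)) by nra.
  assert (1 + z * s <= 2) by nra.
  assert (z * c <= 1) by nra.
  pose proof (Rabs_pos (r - c)); pose proof (Rabs_pos (s - c)); nra.
Qed.

(** * Digits that are constant on square blocks *)

(** Together with [ratio_limit_variation] this bounds the perturbation at step n
    by an increment of a potential of size [O (sqrt n)]. *)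
Lemma inv_le_sqrt_diff n : / INR (S n) <= 2 * sqrt (INR (S n)) - 2 * sqrt (INR n).
Proof.
  pose proof (pos_INR n) as H0; rewrite S_INR.
  set (y := INR n) in *.
  pose proof (sqrt_sqrt y H0) as E0.
  pose proof (sqrt_sqrt (y + 1) ltac:(lra)) as E1.
  assert (Hu : 0 <= sqrt y) by apply sqrt_pos.
  assert (Huv : sqrt y <= sqrt (y + 1)) by (apply sqrt_le_1; lra).
  assert (Hv1 : 1 <= sqrt (y + 1)) by (rewrite <- sqrt_1 at 1; apply sqrt_le_1; lra).
  set (u := sqrt y) in *; set (v := sqrt (y + 1)) in *.
  apply (Rmult_le_reg_l (y + 1)); [lra|].
  rewrite Rinv_r by lra.
  (* since (v - u) (v + u) = 1 and u <= v *)
  assert (H1 : 1 <= 2 * v * (v - u)) by nra.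
  assert (Hv : v <= y + 1) by nra.
  nra.
Qed.

(** The type changes only where [Nat.sqrt] jumps, so its changes are counted by
    [Nat.sqrt] itself. *)
Lemma ratio_limit_variation (h : nat -> bool) n :
  Rabs (ratio_limit (h (Nat.sqrt (S n))) - ratio_limit (h (Nat.sqrt n)))
  <= INR (Nat.sqrt (S n)) - INR (Nat.sqrt n).
Proof.
  pose proof golden_bounds.
  destruct (Nat.sqrt_succ_or n) as [E|E]; rewrite E.
  - rewrite S_INR.
    destruct (h (S (Nat.sqrt n))), (h (Nat.sqrt n)); cbn; apply Rabs_le; lra.
  - rewrite !Rminus_diag, Rabs_R0; lra.
Qed.

Lemma INR_sqrt_le n : INR (Nat.sqrt n) <= sqrt (INR n).
Proof.
  rewrite <- (sqrt_square (INR (Nat.sqrt n))) by apply pos_INR.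
  apply sqrt_le_1; [|apply pos_INR|].
  - apply Rmult_le_pos; apply pos_INR.
  - rewrite <- mult_INR; apply le_INR, Nat.sqrt_spec; lia.
Qed.

(** Let [E] and [F] be the distances of the two ratios to the value expected at n,
    and let [V] absorb the perturbations.  Then [E (S n) <= g E n + dV] and
    [F n <= g F (S n) + dV], with [dV] the increment of [V] and [g = golden].
    As [g < 2/3], these give [E n <= 3 (E n - E (S n) + dV)] and
    [F (S n) <= 3 (F (S n) - F n + dV)]: the deviations telescope, in one
    direction for each ratio. *)
Lemma psum_piece_block_digits (h : nat -> bool) x N :
  let b n := h (Nat.sqrt n) in
  (forall n, 0 < err (mixed_digits b) x n) ->
  Rabs (psum (piece (mixed_digits b) x) N - psum (fun n => piece_limit (b n)) N)
  <= 12 + 42 * sqrt (INR N).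
Proof.
  intros b H.
  set (A := mixed_digits b) in *.
  assert (HA : forall i, (1 <= A i)%Z) by apply mixed_digits_ge_1.
  pose proof golden_bounds as Hg.
  set (c := fun n => ratio_limit (b n)).
  assert (Hc : forall n, 0 <= c n <= 1)
    by (intro n; unfold c; destruct (b n); cbn; lra).
  set (r := denom_ratio A).
  assert (Hr : forall n, 0 <= r n <= 1)
    by (intro n; pose proof (denom_ratio_bounds A n HA); unfold r; lra).
  set (s := err_ratio A x).
  assert (Hs : forall n, 0 <= s n <= 1)
    by (intro n; pose proof (err_ratio_bounds A x n HA H); unfold s; lra).
  set (V := fun n => 2 * sqrt (INR n) + INR (Nat.sqrt n)).
  assert (Hw : forall n, Rabs (c (S n) - c n) + / INR (S n) <= V (S n) - V n).
  { intro n; pose proof (ratio_limit_variation h n); pose proof (inv_le_sqrt_diff n).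
    unfold c, b, V; lra. }
  set (E := fun n => Rabs (r n - c n)).
  set (F := fun n => Rabs (s n - c n)).
  assert (Htri : forall y n, Rabs (y - c (S n)) <= Rabs (y - c n) + Rabs (c (S n) - c n) /\
                 Rabs (y - c n) <= Rabs (y - c (S n)) + Rabs (c (S n) - c n)).
  { intros y n; split.
    - rewrite (Rabs_minus_sym (c (S n))).
      replace (y - c (S n)) with ((y - c n) + (c n - c (S n))) by ring; apply Rabs_triang.
    - replace (y - c n) with ((y - c (S n)) + (c (S n) - c n)) by ring; apply Rabs_triang. }
  assert (HE : forall n, E (S n) <= golden * E n + (V (S n) - V n)).
  { intro n; unfold E, r; rewrite denom_ratio_rec by exact HA; fold r.
    pose proof (inv_digit_contracts b (S n) (r n) (proj1 (Hr n))) as H1.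
    change (ratio_limit (b (S n))) with (c (S n)) in H1; fold A in H1.
    destruct (Htri (r n) n) as [H2 _].
    assert (/ INR (S (S n)) <= / INR (S n)).
    { apply Rinv_le_contravar; [apply lt_0_INR|apply le_INR]; lia. }
    pose proof (Hw n); pose proof (Rabs_pos (c (S n) - c n)); nra. }
  assert (HF : forall n, F n <= golden * F (S n) + (V (S n) - V n)).
  { intro n; unfold F, s.
    rewrite <- (Rinv_inv (err_ratio A x n)), err_ratio_rec by exact H; fold s.
    pose proof (inv_digit_contracts b n (s (S n)) (proj1 (Hs (S n)))) as H1.
    change (ratio_limit (b n)) with (c n) in H1; fold A in H1.
    destruct (Htri (s (S n)) n) as [_ H2].
    pose proof (Hw n); pose proof (Rabs_pos (c (S n) - c n)); nra. }
  (* 2 E n + 2 F (S n) + 2 dV bounds the n-th term; the constants 6 and 14 come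
     from the factor 3 above *)
  set (P := fun n => - 6 * E n + 6 * F n + 14 * V n).
  apply Rle_trans with (P N - P O).
  - apply psum_dist_telescope; intro n.
    apply Rle_trans with (2 * Rabs (r n - c n) + 2 * Rabs (s (S n) - c n)).
    + apply quotient_lipschitz; auto.
      * apply piece_ratio; assumption.
      * apply piece_limit_ratio.
    + destruct (Htri (s (S n)) n) as [_ H2].
      pose proof (HE n); pose proof (HF n); pose proof (Hw n).
      assert (0 < / INR (S n)) by (apply Rinv_0_lt_compat, lt_0_INR; lia).
      fold (E n); fold (F (S n)) in H2.
      assert (0 <= E n) by apply Rabs_pos; assert (0 <= F (S n)) by apply Rabs_pos.
      unfold P; nra.
  - assert (HN : 0 <= E N) by apply Rabs_pos.
    assert (H0 : 0 <= F O) by apply Rabs_pos.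
    assert (HE0 : E O <= 1) by (pose proof (Hr O); pose proof (Hc O); apply Rabs_le; lra).
    assert (HFN : F N <= 1) by (pose proof (Hs N); pose proof (Hc N); apply Rabs_le; lra).
    assert (HVN : V N <= 3 * sqrt (INR N)) by (pose proof (INR_sqrt_le N); unfold V; lra).
    assert (HV0 : V O = 0) by (unfold V; cbn; rewrite sqrt_0; ring).
    unfold P; rewrite HV0; lra.
Qed.

(** * Prescribing the density of the digit 1 *)

Definition floor_diff (th : R) (k : nat) : Z :=
  (Int_part (th * INR (S k)) - Int_part (th * INR k))%Z.

Lemma floor_diff_frac th k :
  IZR (floor_diff th k) - th = frac_part (th * INR k) - frac_part (th * INR (S k)).
Proof. unfold floor_diff, frac_part; rewrite minus_IZR, S_INR; ring. Qed.

Lemma floor_diff_cases th k : 0 <= th <= 1 -> floor_diff th k = 0%Z \/ floor_diff th k = 1%Z.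
Proof.
  intro Hth; pose proof (floor_diff_frac th k).
  pose proof (base_fp (th * INR k)); pose proof (base_fp (th * INR (S k))).
  assert (-1 < floor_diff th k < 2)%Z by (split; apply lt_IZR; lra).
  lia.
Qed.

(** For [0 <= th <= 1], a choice of types in which [true] has density [th]. *)
Definition balanced (th : R) (k : nat) : bool := Z.eqb (floor_diff th k) 1.

(** With [f k] the fractional part of [th k], block k contributes
    [(2k+1) (f k - f (k+1))] to the discrepancy.  Summation by parts turns the sum
    over the blocks before k into [G - (2k-1) f k], where [G] grows by [2 f k]
    when block k is completed, so that [0 <= G <= 2k]; the remaining term is the
    part of the current block that has been covered. *)
Lemma floor_diff_discrepancy th N :
  Rabs (psum (fun n => IZR (floor_diff th (Nat.sqrt n))) N - th * INR N)
  <= 2 + 6 * INR (Nat.sqrt N).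
Proof.
  set (f := fun k => frac_part (th * INR k)).
  assert (Hf : forall k, 0 <= f k < 1)
    by (intro k; pose proof (base_fp (th * INR k)); unfold f; lra).
  assert (Hf0 : f O = 0).
  { unfold f; cbn [INR]; rewrite Rmult_0_r.
    apply (frac_part_unique 0 0 0); lra. }
  assert (HG : exists G, 0 <= G <= 2 * INR (Nat.sqrt N) /\
    psum (fun n => IZR (floor_diff th (Nat.sqrt n))) N - th * INR N
    = G - (2 * INR (Nat.sqrt N) - 1) * f (Nat.sqrt N)
      + (INR N - INR (Nat.sqrt N) * INR (Nat.sqrt N))
        * (f (Nat.sqrt N) - f (S (Nat.sqrt N)))).
  { induction N as [|N [G [HG E]]].
    - exists 0; cbn [psum]; change (Nat.sqrt 0) with 0%nat; cbn [INR]; rewrite Hf0; lra.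
    - pose proof (floor_diff_frac th (Nat.sqrt N)) as D.
      fold (f (Nat.sqrt N)) (f (S (Nat.sqrt N))) in D.
      assert (E' : psum (fun n => IZR (floor_diff th (Nat.sqrt n))) (S N) - th * INR (S N)
        = psum (fun n => IZR (floor_diff th (Nat.sqrt n))) N - th * INR N
          + (f (Nat.sqrt N) - f (S (Nat.sqrt N))))
        by (cbn [psum]; rewrite S_INR, <- D; ring).
      destruct (Nat.sqrt_succ_or N) as [K|K].
      + assert (K2 : (S N = S (Nat.sqrt N) * S (Nat.sqrt N))%nat).
        { pose proof (Nat.sqrt_spec N ltac:(lia)).
          pose proof (Nat.sqrt_spec (S N) ltac:(lia)); rewrite K in *; lia. }
        apply (f_equal INR) in K2; rewrite mult_INR, !S_INR in K2.
        exists (G + 2 * f (Nat.sqrt N)); pose proof (Hf (Nat.sqrt N)).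
        rewrite E', E, K, !S_INR; split; [lra|].
        replace (INR N) with
          ((INR (Nat.sqrt N) + 1) * (INR (Nat.sqrt N) + 1) - 1) by lra.
        ring.
      + exists G; rewrite E', E, K, S_INR; split; [exact HG|ring]. }
  destruct HG as [G [HG ->]].
  pose proof (Nat.sqrt_spec N ltac:(lia)) as [K1 K2].
  assert (K3 : (N <= Nat.sqrt N * Nat.sqrt N + 2 * Nat.sqrt N)%nat) by lia.
  apply le_INR in K1, K3; rewrite plus_INR, !mult_INR in K3; rewrite mult_INR in K1.
  change (INR 2) with 2 in K3.
  pose proof (Hf (Nat.sqrt N)); pose proof (Hf (S (Nat.sqrt N))).
  pose proof (pos_INR (Nat.sqrt N)).
  set (k := INR (Nat.sqrt N)) in *; set (i := INR N - k * k) in *.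
  assert (Hi : 0 <= i <= 2 * k) by (unfold i; lra).
  apply Rabs_le; split; nra.
Qed.

Lemma psum_piece_limit_balanced th N : 0 <= th <= 1 ->
  Rabs (psum (fun n => piece_limit (balanced th (Nat.sqrt n))) N
        - (1 - (1 - golden_piece) * th) * INR N)
  <= 2 + 6 * sqrt (INR N).
Proof.
  intro Hth.
  assert (E : psum (fun n => piece_limit (balanced th (Nat.sqrt n))) N
    = INR N - (1 - golden_piece) * psum (fun n => IZR (floor_diff th (Nat.sqrt n))) N).
  { induction N as [|N IH]; [cbn; ring|].
    cbn [psum]; rewrite IH, S_INR; unfold balanced.
    destruct (floor_diff_cases th (Nat.sqrt N) Hth) as [K|K]; rewrite K; cbn; ring. }
  assert (Hc : 0 <= 1 - golden_piece <= 1)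
    by (pose proof golden_bounds; unfold golden_piece, golden in *; lra).
  rewrite E.
  replace (INR N - _ - _) with
    (- ((1 - golden_piece) *
        (psum (fun n => IZR (floor_diff th (Nat.sqrt n))) N - th * INR N))) by ring.
  rewrite Rabs_Ropp, Rabs_mult, (Rabs_pos_eq (1 - golden_piece)) by lra.
  pose proof (floor_diff_discrepancy th N); pose proof (INR_sqrt_le N).
  pose proof (Rabs_pos (psum (fun n => IZR (floor_diff th (Nat.sqrt n))) N - th * INR N)).
  nra.
Qed.

(** * The limit *)

Lemma convergent_index_exists A t : (forall i, 1 <= A i)%Z -> 1 <= t ->
  exists n, denom A n <= t < denom A (S n).
Proof.
  intros HA Ht.
  assert (H : forall m, t < denom A m -> exists n, denom A n <= t < denom A (S n)).
  { induction m as [|m IH]; intro Hm; [rewrite denom_0 in Hm; lra|].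
    destruct (Rlt_le_dec t (denom A m)) as [K|K]; [exact (IH K)|].
    exists m; split; assumption. }
  destruct (archimed_cor1 (/ t) ltac:(apply Rinv_0_lt_compat; lra)) as [m [Hm Hm0]].
  apply (H m).
  apply lt_INR in Hm0; cbn in Hm0.
  apply Rlt_le_trans with (INR m); [|apply denom_ge_index, HA].
  rewrite <- (Rinv_inv t), <- (Rinv_inv (INR m)).
  apply Rinv_lt_contravar; [|exact Hm].
  apply Rmult_lt_0_compat; apply Rinv_0_lt_compat; lra.
Qed.

Lemma is_lim_average_of_sqrt_bound A (J : R -> R) (N : R -> nat) d C :
  (forall i, 1 <= A i)%Z ->
  (forall t, 1 < t -> denom A (N t) <= t < denom A (S (N t))) ->
  (forall t, 1 < t -> Rabs (J t - d * INR (N t)) <= C * (1 + sqrt (INR (N t)))) ->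
  is_lim (fun t => J t / INR (N t)) p_infty d.
Proof.
  intros HA HN HJ; apply is_lim_spec; intros [e He]; cbn [pos].
  assert (HC : 0 <= C).
  { pose proof (HJ 2 ltac:(lra)); pose proof (sqrt_pos (INR (N 2))).
    pose proof (Rabs_pos (J 2 - d * INR (N 2))); nra. }
  set (y := 2 * C / e).
  destruct (INR_unbounded (y * y)) as [m Hm].
  exists (Rmax 1 (denom A (S m))); intros t Ht.
  assert (Ht1 : 1 < t) by (eapply Rle_lt_trans; [apply Rmax_l|exact Ht]).
  assert (Htm : denom A (S m) < t) by (eapply Rle_lt_trans; [apply Rmax_r|exact Ht]).
  specialize (HN t Ht1); specialize (HJ t Ht1).
  assert (Hk : (S m <= N t)%nat).
  { destruct (Nat.le_gt_cases (S m) (N t)) as [K|K]; [exact K|].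
    pose proof (denom_mono A (S (N t)) (S m) HA K); lra. }
  assert (Hk1 : 1 <= INR (N t)) by (apply (le_INR 1); lia).
  assert (Hk2 : y * y < INR (N t))
    by (eapply Rlt_le_trans; [exact Hm|apply le_INR; lia]).
  set (k := INR (N t)) in *.
  assert (Hs1 : 1 <= sqrt k) by (rewrite <- sqrt_1; apply sqrt_le_1; lra).
  assert (Hs : sqrt k * sqrt k = k) by (apply sqrt_sqrt; lra).
  assert (Hy : y < sqrt k) by nra.
  assert (Hy' : 2 * C < e * sqrt k).
  { apply (Rmult_lt_compat_l e) in Hy; [|exact He].
    unfold y in Hy; replace (e * (2 * C / e)) with (2 * C) in Hy by (field; lra).
    exact Hy. }
  replace (J t / k - d) with ((J t - d * k) / k) by (field; lra).
  unfold Rdiv; rewrite Rabs_mult, (Rabs_pos_eq (/ k))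
    by (left; apply Rinv_0_lt_compat; lra).
  apply (Rmult_lt_reg_r k); [lra|].
  rewrite Rmult_assoc, Rinv_l, Rmult_1_r by lra.
  nra.
Qed.

Theorem theorem3 :
  forall d : R, 1 / 2 - sqrt 5 / 10 <= d <= 1 ->
  exists alpha : R, irrational alpha /\
  exists N : R -> nat,
    (forall t : R, 1 < t -> is_convergent_index alpha t (N t)) /\
    is_lim (fun t : R => I_psi alpha t / INR (N t)) p_infty d.
Proof.
  intros d Hd; fold golden_piece in Hd.
  set (th := (1 - d) / (1 - golden_piece)).
  assert (Hc : 0 < 1 - golden_piece)
    by (pose proof golden_bounds; unfold golden_piece, golden in *; lra).
  assert (Hth : 0 <= th <= 1).
  { unfold th; split; [apply Rdiv_le_0_compat; lra|apply Rle_div_l; lra]. }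
  assert (Ed : 1 - (1 - golden_piece) * th = d) by (unfold th; field; lra).
  set (A := mixed_digits (fun n => balanced th (Nat.sqrt n))).
  assert (HA : forall i, (1 <= A i)%Z) by apply mixed_digits_ge_1.
  destruct (continued_fraction_converges A HA) as [alpha H0].
  pose proof (err_pos A alpha HA H0) as H; clear H0.
  exists alpha; split; [exact (err_pos_irrational A alpha HA H)|].
  set (N := fun t : R =>
    epsilon (inhabits O) (fun n => denom A n <= t < denom A (S n))).
  assert (HN : forall t, 1 < t -> denom A (N t) <= t < denom A (S (N t))).
  { intros t Ht; apply (epsilon_spec (inhabits O)), convergent_index_exists;
      [exact HA|lra]. }
  exists N; split.
  { intros t Ht; unfold is_convergent_index.
    rewrite !(convergent_denom_eq A) by assumption; exact (HN t Ht). }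
  (* 48 = 42 + 6 adds the coefficients of the two square roots; the constant
     terms 12 + 2 and the incomplete last piece, at most 1, fit below it *)
  apply (is_lim_average_of_sqrt_bound A _ N d 48 HA HN); intros t Ht.
  specialize (HN t Ht); rewrite (I_psi_eq A alpha (N t) t HA H HN).
  pose proof (psum_piece_block_digits (balanced th) alpha (N t) H) as H1.
  pose proof (psum_piece_limit_balanced th (N t) Hth) as H2.
  rewrite Ed in H2; cbv zeta in H1; fold A in H1.
  assert (H3 : 0 <= err A alpha (N t) * (t - denom A (N t)) <= 1).
  { pose proof (err_denom A alpha (N t)).
    pose proof (H (N t)); pose proof (H (S (N t))).
    pose proof (denom_ge_1 A (N t) HA); nra. }
  apply Rabs_le_between in H1, H2; apply Rabs_le; lra.
Qed.
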